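(* Let $k\ge1$, $a,a_i,b_i,c_i\in\mathbb{C}$ ($1\le i\le k$) with $\prod_{j=1}^kc_j\neq0$ and $\prod_{j=1}^kb_j\neq0$, let $f$ be the symbol below and $T^a(f)=T(f)+a\,\mathbf{e}_1\mathbf{e}_1^{\top}$ the perturbed tridiagonal $k$-Toeplitz operator, and let $\lambda\in\mathbb{C}\setminus\sigma_{ess}(T^a(f))$. If $\sum_{j=1}^k\operatorname{wind}(\lambda_j(\mathbb{T}),\lambda)<0$, then there exist an eigenvector $\mathbf{x}$ of $T^a(f)$ associated to $\lambda$ and some $\rho<1$ such that $$\frac{|\mathbf{x}_j|}{\max_i|\mathbf{x}_i|}\le C\lceil j/k\rceil\rho^{\lceil j/k\rceil-1},\qquad j\ge1,$$ where $C>0$ depends only on $\lambda,a_j,b_j,c_j$, $j=1,\dots,k$. If $\sum_{j=1}^k\operatorname{wind}(\lambda_j(\mathbb{T}),\lambda)>0$, the same conclusion holds for left eigenvectors of $T^a(f)$ associated to $\lambda$.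
   Context: The tridiagonal $k$-Toeplitz operator $T(f)$ on $\ell^2(\mathbb{N})$ has matrix entries $(i,i)=a_{p(i)}$, $(i,i+1)=b_{p(i)}$, $(i+1,i)=c_{p(i)}$, $p(i)=((i-1)\bmod k)+1$, all other entries zero; $T^a(f)$ is the same operator with $(1,1)$ entry replaced by $a_1+a$. The symbol is $f(z)=A_{-1}z^{-1}+A_0+A_1z$, where $A_0$ is the $k\times k$ tridiagonal matrix with diagonal $a_1,\dots,a_k$, superdiagonal $b_1,\dots,b_{k-1}$, subdiagonal $c_1,\dots,c_{k-1}$; $A_{-1}$ has single nonzero entry $b_k$ at $(k,1)$; $A_1$ has single nonzero entry $c_k$ at $(1,k)$. $\mathbb{T}$ is the unit circle; $\sigma_{ess}$ denotes the essential spectrum (set of $\lambda$ with operator minus $\lambda$ not Fredholm). With $\lambda_1(z),\dots,\lambda_k(z)$ the eigenvalues of $f(z)$, $\sum_j\operatorname{wind}(\lambda_j(\mathbb{T}),\lambda)$ is the winding number about $0$ of $z\mapsto\det(f(z)-\lambda I)$ as $z$ traverses $\mathbb{T}$ counterclockwise. A left eigenvector is a nonzero $\mathbf{y}$ with $\mathbf{y}^\top T^a(f)=\lambda\mathbf{y}^\top$. *)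

(* Defs.v *)
From HB Require Import structures.
From mathcomp Require Import all_boot all_order all_algebra.
From mathcomp Require Import all_classical all_reals all_analysis.
From mathcomp Require Import complex.
Set Implicit Arguments. Unset Strict Implicit. Unset Printing Implicit Defensive.
Import Order.TTheory GRing.Theory Num.Theory.
Import numFieldNormedType.Exports.
Local Open Scope ring_scope.
Local Open Scope classical_set_scope.

(* Conventions: sequences in l^2(N) are x : nat -> R[i] with x n standing for
   the paper's x_{n+1} (0-based indices).  The coefficient families
   a b c : nat -> R[i] are 1-based: the paper's a_j is (a j), 1 <= j <= k. *)

Section Defs.
Variable R : realType.
Local Notation C := (R[i]).

Definition cabs (z : C) : R := Normc.normc z.

(* label p(i) of the 0-based index n, i.e. p(n+1) = (n mod k) + 1 *)
Definition lab (k n : nat) : nat := (n %% k).+1.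

Definition Tent (k : nat) (a b c : nat -> C) (a0 : C) (i j : nat) : C :=
  if i == j then a (lab k i) + (if i == 0%N then a0 else 0)
  else if j == i.+1 then b (lab k i)
  else if i == j.+1 then c (lab k j)
  else 0.

(* A banded (tridiagonal) infinite matrix, applied to a sequence *)
Definition mx_right (M : nat -> nat -> C) (x : nat -> C) : nat -> C :=
  fun i => \sum_(0 <= j < i.+2) M i j * x j.
Definition mx_left (y : nat -> C) (M : nat -> nat -> C) : nat -> C :=
  fun j => \sum_(0 <= i < j.+2) y i * M i j.

Definition mx_shift (M : nat -> nat -> C) (lam : C) : nat -> nat -> C :=
  fun i j => M i j - (if i == j then lam else 0).

Definition sq_sum (x : nat -> C) : nat -> R :=
  series (fun n => cabs (x n) ^+ 2).
Definition in_l2 (x : nat -> C) : Prop := cvgn (sq_sum x).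
Definition l2norm2 (x : nat -> C) : R := limn (sq_sum x).

Definition lincomb (m : nat) (coef : 'I_m -> C) (v : 'I_m -> nat -> C) :=
  fun n => \sum_(i < m) coef i * v i n.

(* Fredholmness of the (bounded, banded) operator x |-> M x on l^2(N):
   finite-dimensional kernel, closed range, finite-dimensional cokernel. *)
Definition fredholm (M : nat -> nat -> C) : Prop :=
  [/\ (exists m (v : 'I_m -> nat -> C), (forall i, in_l2 (v i)) /\
         forall x, in_l2 x -> mx_right M x = (fun _ => 0) ->
           exists coef, x = lincomb coef v),
      (forall y, in_l2 y ->
         (exists xs : nat -> nat -> C, (forall m, in_l2 (xs m)) /\
            (fun m => l2norm2 (fun n => mx_right M (xs m) n - y n)) @ \oo --> 0) ->
         exists x, in_l2 x /\ mx_right M x = y)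
    & (exists m (v : 'I_m -> nat -> C), (forall i, in_l2 (v i)) /\
         forall y, in_l2 y -> exists x coef, in_l2 x /\
           y = (fun n => mx_right M x n + lincomb coef v n))].

Definition ess_spec (M : nat -> nat -> C) : set C :=
  [set lam | ~ fredholm (mx_shift M lam)].

Definition symb (k : nat) (a b c : nat -> C) (z : C) : 'M[C]_k :=
  \matrix_(i < k, j < k)
    ((if i == j :> nat then a i.+1
      else if j == i.+1 :> nat then b i.+1
      else if i == j.+1 :> nat then c j.+1 else 0)
     + (if (i == k.-1 :> nat) && (j == 0%N :> nat) then b k * z^-1 else 0)
     + (if (i == 0%N :> nat) && (j == k.-1 :> nat) then c k * z else 0)).

Definition expi (t : R) : C := Complex (cos t) (sin t).

Definition winding (g : R -> C) (w : int) : Prop :=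
  (forall t, 0 <= t <= 1 -> g t != 0) /\
  exists theta : R -> R,
    {within `[0, 1]%classic, continuous theta} /\
    (forall t, 0 <= t <= 1 -> g t = (cabs (g t))%:C%C * expi (theta t)) /\
    theta 1 - theta 0 = 2 * pi * w%:~R.

Definition det_curve (k : nat) (a b c : nat -> C) (lam : C) : R -> C :=
  fun t => \det (symb k a b c (expi (2 * pi * t)) - lam%:M).

Definition ceil_div (j k : nat) : nat := (j + k.-1) %/ k.

Definition decays (k : nat) (Cst rho : R) (x : nat -> C) : Prop :=
  exists i0, (forall i, cabs (x i) <= cabs (x i0)) /\
    forall n : nat, cabs (x n) / cabs (x i0)
      <= Cst * (ceil_div n.+1 k)%:R * rho ^+ (ceil_div n.+1 k).-1.

End Defs.

(* Main.v *)
Require Import Defs.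
From HB Require Import structures.
From mathcomp Require Import all_boot all_order all_algebra.
From mathcomp Require Import all_classical all_reals all_analysis.
From mathcomp Require Import complex.
From mathcomp Require Import ring lra zify.
Import Order.TTheory GRing.Theory Num.Theory.
Import numFieldNormedType.Exports.
Local Open Scope ring_scope.

(** The symbol satisfies [det (f z - lam) = al z + be / z + D], where [al] and
    [be] are [prod c] and [prod b] up to a common sign.  If [z1], [z2] are the
    roots of [al z^2 + D z + be], the winding number is the number of roots in
    the unit disk minus one, so it is negative iff [|z1|, |z2| > 1].  A kernel
    vector of [f z1 - lam] extends to a Floquet solution [u] of the three-term
    recurrence with multiplier [1 / z1], and the Casoratian then gives
    [v (n + k) = v n / z2 + kappa u n] for every solution [v].  Hence all
    solutions decay like [m rho^m], in particular the one that matches the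
    perturbed first row.  Left eigenvectors are right eigenvectors after
    exchanging [b] and [c], which reverses the curve. *)

Lemma det_add_delta (A : comPzRingType) n (M : 'M[A]_n) (s : A) i0 j0 :
  \det (M + s *: delta_mx i0 j0) = \det M + s * cofactor M i0 j0.
Proof.
rewrite (expand_det_row _ i0) (expand_det_row M i0).
have cofE j : cofactor (M + s *: delta_mx i0 j0) i0 j = cofactor M i0 j.
  rewrite /cofactor; congr (_ * \det _); apply/matrixP => p q.
  by rewrite !mxE eq_sym (negbTE (neq_lift _ _)) mulr0 addr0.
under eq_bigr => j _ do rewrite cofE !mxE eqxx /= mulrDl.
rewrite big_split /=; congr (_ + _).
rewrite (bigD1 j0) //= eqxx mulr1 big1 ?addr0 // => j /negbTE ->.
by rewrite mulr0 mul0r.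
Qed.

Lemma det_add_corners (A : comNzRingType) n (M : 'M[A]_n.+1) :
  exists D0 D1 : A, forall s t : A,
    \det (M + s *: delta_mx ord_max ord0 + t *: delta_mx ord0 ord_max) =
    D0 + s * cofactor M ord_max ord0 + t * cofactor M ord0 ord_max + s * t * D1.
Proof.
exists (\det M).
case: n M => [|n] M.
  exists 0 => s t; rewrite !det_add_delta.
  by rewrite /cofactor !det_mx00 /=; ring.
exists ((-1) ^+ n.+1 *
   cofactor (row' ord0 (col' ord_max M)) ord_max ord0) => s t.
rewrite !det_add_delta.
suff -> : cofactor (M + s *: delta_mx ord_max ord0) ord0 ord_max =
    cofactor M ord0 ord_max + s * ((-1) ^+ n.+1 *
    cofactor (row' ord0 (col' ord_max M)) ord_max ord0) by ring.
rewrite {1 2}/cofactor.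
rewrite mulrCA -mulrDr -det_add_delta; congr (_ * \det _); apply/matrixP => i j.
rewrite !mxE -![in LHS]val_eqE -![in RHS]val_eqE /= /bump.
by rewrite add1n eqSS (_ : (n < j)%N = false) //; have := ltn_ord j; lia.
Qed.

Section Periodic.
Variable (R : realType).
Local Notation C := (R[i]).
Variables (a b c : nat -> C) (lam : C).

Definition band_mx k : 'M[C]_k := \matrix_(i, j)
  ((if i == j :> nat then a i.+1
      else if j == i.+1 :> nat then b i.+1
      else if i == j.+1 :> nat then c j.+1 else 0)
    - (if i == j :> nat then lam else 0)).

Lemma symb_band n (z : C) :
  symb n.+1 a b c z - lam%:M =
  band_mx n.+1 + (b n.+1 * z^-1) *: delta_mx ord_max ord0
     + (c n.+1 * z) *: delta_mx ord0 ord_max.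
Proof.
apply/matrixP => i j; rewrite !mxE -!val_eqE /=.
case: (_ == _ :> nat); case: (_ == n); case: (_ == 0%N);
 case: (_ == 0%N); case: (_ == n) => //=;
 rewrite ?mulr1n ?mulr0n ?mulr1 ?mulr0; ring.
Qed.

Lemma cofactor_band_lower n :
  cofactor (band_mx n.+1) ord_max ord0 = (-1) ^+ n * \prod_(i < n) b i.+1.
Proof.
rewrite /cofactor addn0 det_trig.
  congr (_ * _); apply: eq_bigr => i _; rewrite !mxE /= /bump.
  rewrite leqNgt ltn_ord leq0n add0n add1n eqxx.
  by rewrite (ltn_eqF (ltnSn i)) subr0.
apply/is_trig_mxP => i j ij; rewrite !mxE /= /bump.
rewrite leqNgt ltn_ord leq0n add0n add1n.
rewrite (ltn_eqF (leqW ij)) eqSS (gtn_eqF ij).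
by rewrite (ltn_eqF (leqW (leqW ij))) subr0.
Qed.

Lemma cofactor_band_upper n :
  cofactor (band_mx n.+1) ord0 ord_max = (-1) ^+ n * \prod_(i < n) c i.+1.
Proof.
rewrite /cofactor add0n -det_tr det_trig.
  congr (_ * _); apply: eq_bigr => i _; rewrite !mxE /= /bump.
  rewrite [(n <= i)%N]leqNgt ltn_ord leq0n add0n add1n eqxx.
  by rewrite (gtn_eqF (ltnSn i)) (ltn_eqF (leqW (ltnSn i))) subr0.
apply/is_trig_mxP => i j ij; rewrite !mxE /= /bump.
rewrite [(n <= i)%N]leqNgt ltn_ord leq0n add0n add1n.
rewrite (gtn_eqF (leqW ij)) (ltn_eqF (leqW (leqW ij))).
by rewrite eqSS (gtn_eqF ij) subr0.
Qed.

Lemma det_symb k : (0 < k)%N ->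
  exists D : C, forall z, z != 0 ->
    \det (symb k a b c z - lam%:M) =
    (-1) ^+ k.-1 * \prod_(1 <= j < k.+1) c j * z
    + (-1) ^+ k.-1 * \prod_(1 <= j < k.+1) b j * z^-1 + D.
Proof.
case: k => // n _; have [D0 [D1 DE]] := det_add_corners _ _ (band_mx n.+1).
exists (D0 + b n.+1 * c n.+1 * D1) => z z0.
rewrite symb_band DE cofactor_band_lower cofactor_band_upper /=.
rewrite !big_add1 /= !big_nat_recr //= !big_mkord; field.
exact: z0.
Qed.


Section Recurrence.
Variable k : nat.
Hypothesis k_gt0 : (0 < k)%N.
Hypothesis prod_b_neq0 : \prod_(1 <= j < k.+1) b j != 0.

Definition bulk_sol (x : nat -> C) := forall n,
  c (lab k n) * x n + (a (lab k n.+1) - lam) * x n.+1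
    + b (lab k n.+1) * x n.+2 = 0.

Lemma lab_small n : (n < k)%N -> lab k n = n.+1.
Proof. by move=> nk; rewrite /lab modn_small. Qed.

Lemma lab_addk n : lab k (n + k) = lab k n.
Proof. by rewrite /lab modnDr. Qed.

Lemma prod_lab (f : nat -> C) :
  \prod_(0 <= j < k) f (lab k j) = \prod_(1 <= j < k.+1) f j.
Proof.
rewrite big_add1; apply: eq_big_nat => j /andP[_ jk].
by rewrite lab_small.
Qed.

Lemma prod_labS (f : nat -> C) :
  \prod_(0 <= j < k) f (lab k j.+1) = \prod_(1 <= j < k.+1) f j.
Proof.
rewrite -prod_lab /lab -(prednK k_gt0).
by rewrite big_nat_recr // [RHS]big_nat_recl //= modnn mod0n mulrC.
Qed.

Lemma b_lab_neq0 n : b (lab k n) != 0.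
Proof.
have lk : (n %% k < k)%N by rewrite ltn_mod.
move: prod_b_neq0; rewrite big_add1 big_mkord prodf_seq_neq0 => /allP.
by move=> /(_ (Ordinal lk)); rewrite mem_index_enum => /(_ isT).
Qed.

Lemma bulk_sol_lincomb x y p : bulk_sol x -> bulk_sol y ->
  bulk_sol (fun n => x n - p * y n).
Proof.
move=> sx sy n; rewrite /=; transitivity (0 - p * 0 : C); last by ring.
by rewrite -{1}(sx n) -(sy n); ring.
Qed.

Lemma bulk_sol_shift x : bulk_sol x -> bulk_sol (fun n => x (n + k)%N).
Proof. by move=> sx n; have := sx (n + k)%N; rewrite -!addSn !lab_addk. Qed.

Lemma bulk_sol_eq0 x : bulk_sol x -> x 0%N = 0 -> x 1%N = 0 ->
  forall n, x n = 0.
Proof.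
move=> sx x0 x1 n; suff: x n = 0 /\ x n.+1 = 0 by case.
elim: n => // n [xn xn1]; split=> //; have := sx n.
rewrite xn xn1 !mulr0 !add0r => /eqP; rewrite mulf_eq0.
by rewrite (negbTE (b_lab_neq0 _)) => /eqP.
Qed.

Lemma casoratian x y n : bulk_sol x -> bulk_sol y ->
  (x n * y n.+1 - x n.+1 * y n) * \prod_(0 <= j < n) b (lab k j.+1) =
  (x 0%N * y 1%N - x 1%N * y 0%N) * \prod_(0 <= j < n) c (lab k j).
Proof.
move=> sx sy; elim: n => [|n IH]; first by rewrite !big_geq.
rewrite !big_nat_recr //= [in RHS]mulrA -IH.
suff e : (x n.+1 * y n.+2 - x n.+2 * y n.+1) * b (lab k n.+1) =
    (x n * y n.+1 - x n.+1 * y n) * c (lab k n).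
  by rewrite mulrA mulrAC e; ring.
apply/eqP; rewrite -subr_eq0; apply/eqP.
transitivity (x n.+1 * 0 - y n.+1 * 0 : C); last by ring.
by rewrite -{1}(sy n) -(sx n); ring.
Qed.

(* One Floquet solution determines the shift by a period on all solutions: the
   other multiplier is read off the Casoratian. *)
Lemma floquet_shift mu1 mu2 u v :
  mu1 != 0 -> mu1 * mu2 * \prod_(1 <= j < k.+1) b j = \prod_(1 <= j < k.+1) c j ->
  bulk_sol u -> (forall n, u (n + k)%N = mu1 * u n) ->
  (u 0%N != 0) || (u 1%N != 0) -> bulk_sol v ->
  exists kappa, forall n, v (n + k)%N = mu2 * v n + kappa * u n.
Proof.
move=> mu1_neq0 mu12 su ub u_neq0 sv.
pose d n := v (n + k)%N - mu2 * v n.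
have sd : bulk_sol d by apply: bulk_sol_lincomb => //; apply: bulk_sol_shift.
have W0 : u 0%N * d 1%N = u 1%N * d 0%N.
  have := casoratian u v k su sv.
  rewrite prod_lab prod_labS -mu12 [RHS]mulrA.
  move/(mulIf prod_b_neq0); have := ub 0%N; have := ub 1%N.
  rewrite /d !add0n !add1n => -> -> e; apply: (mulfI mu1_neq0).
  by apply/eqP; rewrite -subr_eq0; move/eqP: e; rewrite -subr_eq0 => /eqP <-;
    apply/eqP; ring.
have [p [p0 p1]] : exists p, d 0%N = p * u 0%N /\ d 1%N = p * u 1%N.
  have [u0|u0] := eqVneq (u 0%N) 0.
    rewrite u0 eqxx /= in u_neq0; exists (d 1%N / u 1%N); rewrite divfK //.
    split=> //; apply: (mulfI u_neq0).
    by rewrite -W0 u0 mul0r !mulr0.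
  exists (d 0%N / u 0%N); rewrite divfK //; split=> //; apply: (mulfI u0).
  by rewrite W0; field.
exists p => n.
have := @bulk_sol_eq0 (fun n => d n - p * u n) (bulk_sol_lincomb _ _ p sd su).
rewrite p0 p1 !subrr => /(_ erefl erefl n) /eqP.
by rewrite subr_eq0 /d subr_eq => /eqP ->; rewrite addrC.
Qed.

End Recurrence.

Lemma sum_if_eq (k p : nat) (f : nat -> C) :
  \sum_(0 <= j < k) (if j == p then f j else 0) = if (p < k)%N then f p else 0.
Proof.
rewrite big_mkord; case: ifPn => pk.
  rewrite (bigD1 (Ordinal pk)) //= eqxx big1 ?addr0 // => j jp.
  by rewrite -val_eqE /= in jp; rewrite (negbTE jp).
by rewrite big1 // => j _; case: eqP => // jp; have := ltn_ord j; rewrite jp (negbTE pk).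
Qed.

Lemma symb_mul_col n (z : C) (v : nat -> C) (i : 'I_n.+1) :
  \sum_(j < n.+1) (symb n.+1 a b c z - lam%:M) i j * v j =
  (a i.+1 - lam) * v i
  + (if (i < n)%N then b i.+1 * v i.+1 else b n.+1 * z^-1 * v 0%N)
  + (if (0 < i)%N then c i * v i.-1 else c n.+1 * z * v n).
Proof.
transitivity (\sum_(0 <= j < n.+1)
   ((if j == i then (a i.+1 - lam) * v j else 0)
   + (if j == i.+1 then b i.+1 * v j else 0)
   + (if j == i.-1 then (if (0 < i)%N then c j.+1 * v j else 0) else 0)
   + (if j == 0%N then (if i == n :> nat then b n.+1 * z^-1 * v j else 0) else 0)
   + (if j == n then (if i == 0%N :> nat then c n.+1 * z * v j else 0) else 0))).
  rewrite [RHS]big_mkord; apply: eq_bigr => j _; rewrite !mxE -!val_eqE /=.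
  have -> : (if (j : nat) == i.-1 then if (0 < i)%N then c j.+1 * v j else 0 else 0)
      = (if (i : nat) == j.+1 then c j.+1 * v j else 0).
    by case: (i : nat) => [|m] /=; [case: ifP | rewrite eqSS eq_sym].
  rewrite (eq_sym (j : nat) i).
  have [ij|_] := eqVneq (i : nat) j.
    have -> : ((j : nat) == i.+1) = false by rewrite ij; apply: ltn_eqF.
    have -> : ((i : nat) == j.+1) = false by rewrite ij; apply: ltn_eqF.
    by do 2 (case: (_ == n); case: (_ == 0%N)) => /=; rewrite mulr1n; ring.
  have [ji|_] := eqVneq (j : nat) i.+1.
    have -> : ((i : nat) == j.+1) = false by rewrite ji; apply: ltn_eqF.
    by do 2 (case: (_ == n); case: (_ == 0%N)) => /=; rewrite mulr0n; ring.
  case: (_ == _.+1);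
  by do 2 (case: (_ == n); case: (_ == 0%N)) => /=; rewrite mulr0n; ring.
rewrite !big_split /= !sum_if_eq ltn_ord (leq_ltn_trans (leq_pred i) (ltn_ord i)).
rewrite ltn0Sn ltnSn.
rewrite -!addrA; congr (_ + _); rewrite ltnS.
have [-> //=|i0] := eqVneq (i : nat) 0%N.
  by rewrite add0r addrA; case: n i => [|n] i /=; rewrite ?addr0 ?add0r.
rewrite lt0n i0 addr0 prednK ?lt0n //.
have [-> /=|ine] := eqVneq (i : nat) n; first by rewrite ltnn add0r addrC.
by rewrite addr0 ltn_neqAle ine -ltnS ltn_ord.
Qed.

Lemma floquet_solution k (z : C) : (0 < k)%N ->
  \prod_(1 <= j < k.+1) b j != 0 -> z != 0 ->
  \det (symb k a b c z - lam%:M) = 0 ->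
  exists u, [/\ bulk_sol k u, forall n, u (n + k)%N = z^-1 * u n
     & (u 0%N != 0) || (u 1%N != 0)].
Proof.
case: k => // n _ b0 z0 /eqP; rewrite -det_tr => /det0P [w w0 wM].
pose v (j : nat) : C := w 0 (inord j).
have vM (i : 'I_n.+1) : \sum_(j < n.+1) (symb n.+1 a b c z - lam%:M) i j * v j = 0.
  move/matrixP/(_ 0 i): wM; rewrite [X in _ = X -> _]mxE mxE => e.
  rewrite -[RHS]e; apply: eq_bigr => j _.
  by rewrite [in RHS]mxE mulrC /v inord_val.
pose u (m : nat) : C := z^-1 ^+ (m %/ n.+1) * v (m %% n.+1)%N.
have uE q r : (r < n.+1)%N -> u (q * n.+1 + r)%N = z^-1 ^+ q * v r.
  by move=> rn; rewrite /u divnMDl // divn_small // addn0 modnMDl modn_small.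
have su : bulk_sol n.+1 u.
  move=> m.
  set q := (m.+1 %/ n.+1)%N; set r := (m.+1 %% n.+1)%N.
  have mE : m.+1 = (q * n.+1 + r)%N by rewrite -divn_eq.
  have rn : (r < n.+1)%N by rewrite ltn_mod.
  have labS : lab n.+1 m.+1 = r.+1 by [].
  have := vM (Ordinal rn); rewrite symb_mul_col /= => e.
  transitivity (z^-1 ^+ q * 0 : C); last by rewrite mulr0.
  rewrite -e labS; have -> : u m.+1 = z^-1 ^+ q * v r by rewrite mE uE.
  have -> : b r.+1 * u m.+2 = z^-1 ^+ q *
     (if (r < n)%N then b r.+1 * v r.+1 else b n.+1 / z * v 0%N).
    case: ifPn => rn'.
      by rewrite mE -addnS uE //; ring.
    have rE : r = n by lia.
    have -> : m.+2 = (q.+1 * n.+1 + 0)%N by rewrite mE rE mulSn; lia.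
    by rewrite uE // exprSr rE; ring.
  have -> : c (lab n.+1 m) * u m = z^-1 ^+ q *
     (if (0 < r)%N then c r * v r.-1 else c n.+1 * z * v n).
    case: ifPn => r0.
      have -> : m = (q * n.+1 + r.-1)%N by lia.
      rewrite uE; last by lia.
      rewrite /lab modnMDl modn_small; last by lia.
      by rewrite prednK //; ring.
    have rE : r = 0%N by lia.
    have q0 : (0 < q)%N by move: mE; rewrite rE; case: (q).
    have -> : m = (q.-1 * n.+1 + n)%N.
      by move: mE; rewrite rE -{1}(prednK q0) mulSn; lia.
    rewrite uE // /lab modnMDl modn_small //.
    rewrite -{2}(prednK q0) exprS; field; exact: z0.
  move: (z^-1 ^+ q) => Z; case: ifP; case: ifP => _ _; ring.
exists u; split=> //.
  move=> m; rewrite /u modnDr divnDr ?dvdnn // divnn /= addn1 exprS.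
  by rewrite mulrA.
apply: contra_neqT w0; rewrite negb_or !negbK => /andP[/eqP u0 /eqP u1].
apply/rowP => j; rewrite mxE.
have := @bulk_sol_eq0 n.+1 isT b0 u su u0 u1 j.
by rewrite /u divn_small // modn_small // expr0 mul1r /v inord_val.
Qed.

End Periodic.

Section Modulus.
Variable R : realType.
Local Notation C := (R[i]).
Implicit Types x y : C.

Lemma cabs_ge0 x : 0 <= cabs x.
Proof. by case: x => p q; apply: sqrtr_ge0. Qed.

Lemma cabs0 : cabs (0 : C) = 0.
Proof. exact: Normc.normc0. Qed.

Lemma cabsM x y : cabs (x * y) = cabs x * cabs y.
Proof. exact: Normc.normcM. Qed.

Lemma cabsV x : cabs x^-1 = (cabs x)^-1.
Proof. exact: Normc.normcV. Qed.

Lemma cabsN x : cabs (- x) = cabs x.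
Proof. exact: normcN. Qed.

Lemma cabsD x y : cabs (x + y) <= cabs x + cabs y.
Proof. exact: le_normcD. Qed.

Lemma cabs_eq0 x : (cabs x == 0) = (x == 0).
Proof.
by apply/eqP/eqP => [/Normc.eq0_normc //|->]; rewrite cabs0.
Qed.

Lemma cabs_gt0 x : (0 < cabs x) = (x != 0).
Proof. by rewrite lt0r cabs_ge0 andbT cabs_eq0. Qed.

End Modulus.

Section Summability.
Variable R : realType.
Local Notation C := (R[i]).

Lemma bounded_sum_of_contraction (k : nat) (rho H : R) (e h : nat -> R) :
  rho < 1 -> (forall n, 0 <= e n) ->
  (forall n, e (n + k)%N <= rho * e n + h n) ->
  (forall N, \sum_(0 <= n < N) h n <= H) ->
  exists B, forall N, \sum_(0 <= n < N) e n <= B.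
Proof.
move=> rho1 e0 ek hH; exists ((\sum_(0 <= n < k) e n + H) / (1 - rho)) => N.
rewrite ler_pdivlMr ?subr_gt0 // mulrBr mulr1 lerBlDr.
have le1 : \sum_(0 <= n < N) e n <= \sum_(0 <= n < N + k) e n.
  rewrite [leRHS](@big_cat_nat _ _ _ N) ?leq_addr //= lerDl.
  by apply: sumr_ge0 => n _.
apply: (le_trans le1).
rewrite addnC (@big_cat_nat _ _ _ k) ?leq_addr //= -addrA lerD2l.
rewrite -{1}[k]add0n big_addn addKn addrC mulr_suml.
apply: (@le_trans _ _ (\sum_(0 <= n < N) (e n * rho + h n))).
  by apply: ler_sum => n _; rewrite [_ * rho]mulrC ek.
by rewrite big_split /= lerD2l.
Qed.

Lemma cvg_series_bounded (e : nat -> R) (B : R) : (forall n, 0 <= e n) ->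
  (forall N, \sum_(0 <= n < N) e n <= B) -> cvgn (series e).
Proof.
move=> e0 eB; apply: nondecreasing_is_cvgn.
  by apply/nondecreasing_seqP => n; rewrite /series /= big_nat_recr //= lerDl.
by exists B => _ [n _ <-]; rewrite /series /=.
Qed.

Lemma bounded_sum_max (e : nat -> R) (B : R) : (forall n, 0 <= e n) ->
  (forall N, \sum_(0 <= n < N) e n <= B) -> exists i0, forall i, e i <= e i0.
Proof.
move=> e0 eB.
have [[j ej]|] := pselect (exists j, 0 < e j); last first.
  move=> /forallNP ne; exists 0%N => i; apply: (le_trans _ (e0 _)).
  by rewrite leNgt; apply/negP.
have /cvgrPdist_lt /(_ _ ej) [N _ NP] := cvg_series_cvg_0 (cvg_series_bounded e B e0 eB).
have [i0 i0P] : exists i0, forall i, (i < (N + j).+1)%N -> e i <= e i0.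
  elim: (N + j)%N => [|m [i0 IH]].
    by exists 0%N => i; rewrite ltnS leqn0 => /eqP ->.
  have [le|lt] := leP (e m.+1) (e i0).
    by exists i0 => i; rewrite ltnS leq_eqVlt => /orP[/eqP -> //|/IH].
  exists m.+1 => i; rewrite ltnS leq_eqVlt => /orP[/eqP -> //|/IH le].
  exact: (le_trans le (ltW lt)).
exists i0 => i; have [/i0P //|iN] := ltnP i (N + j).+1.
have /NP /= : (N <= i)%N by lia.
rewrite sub0r normrN ger0_norm // => /ltW le; apply: (le_trans le).
by apply: i0P; lia.
Qed.

Lemma in_l2_bounded_sum (x : nat -> C) (B : R) :
  (forall N, \sum_(0 <= n < N) cabs (x n) <= B) -> in_l2 x.
Proof.
move=> xB; have x0 n : 0 <= cabs (x n) by apply: cabs_ge0.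
have [i0 i0P] := bounded_sum_max _ B x0 xB.
apply: (@cvg_series_bounded _ (cabs (x i0) * B)) => [n|N].
  by rewrite exprn_ge0.
apply: (@le_trans _ _ (\sum_(0 <= n < N) cabs (x i0) * cabs (x n))).
  by apply: ler_sum => n _; rewrite expr2 ler_wpM2r.
by rewrite -mulr_sumr ler_wpM2l.
Qed.

Lemma ceil_divS n k : (0 < k)%N -> ceil_div n.+1 k = (n %/ k).+1.
Proof.
by move=> k0; rewrite /ceil_div addSnnS prednK // divnDr // divnn k0 addn1.
Qed.

(* The constant is independent of the solution because both [v n] and
   [v (n + k)] are already bounded by the maximum of the sequence. *)
Lemma floquet_decay (k : nat) (rho : R) (mu1 mu2 kappa : C) (u v : nat -> C) :
  (0 < k)%N -> 0 < rho < 1 -> cabs mu1 <= rho -> cabs mu2 <= rho ->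
  (forall n, u (n + k)%N = mu1 * u n) ->
  (forall n, v (n + k)%N = mu2 * v n + kappa * u n) ->
  in_l2 v /\ decays k (1 + rho^-1) rho v.
Proof.
move=> k0 /andP[rho0 rho1] mu1r mu2r uk vk.
have [Bu uB] : exists B, forall N, \sum_(0 <= n < N) cabs (u n) <= B.
  apply: (@bounded_sum_of_contraction k rho 0 _ (fun=> 0)) => // [n|n|N].
  - exact: cabs_ge0.
  - by rewrite addr0 uk cabsM ler_wpM2r // cabs_ge0.
  - by rewrite big1.
have [B vB] : exists B, forall N, \sum_(0 <= n < N) cabs (v n) <= B.
  apply: (@bounded_sum_of_contraction k rho (cabs kappa * Bu) _
    (fun n => cabs kappa * cabs (u n))) => // [n|n|N].
  - exact: cabs_ge0.
  - rewrite vk (le_trans (cabsD _ _ _)) // !cabsM lerD2r ler_wpM2r //.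
    exact: cabs_ge0.
  - by rewrite -mulr_sumr ler_wpM2l // cabs_ge0.
split; first exact: in_l2_bounded_sum vB.
have [i0 i0P] := bounded_sum_max _ B (fun n => cabs_ge0 _ (v n)) vB.
exists i0; split=> // n; set M := cabs (v i0).
have M0 : 0 <= M by apply: cabs_ge0.
pose d n := kappa * u n.
have dM r m : cabs (d (r + m * k)%N) <= rho ^+ m * ((1 + rho) * M).
  elim: m => [|m IH].
    rewrite addn0 expr0 mul1r; have -> : d r = v (r + k)%N - mu2 * v r.
      by rewrite vk /d addrC addKr.
    rewrite (le_trans (cabsD _ _ _)) // cabsN cabsM mulrDl mul1r lerD //.
    by rewrite ler_pM ?cabs_ge0.
  rewrite mulSn addnCA addnC /d uk mulrCA cabsM exprS -mulrA.
  by rewrite ler_pM ?cabs_ge0.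
have vM r m : cabs (v (r + m * k)%N) <= (1 + rho^-1) * m.+1%:R * rho ^+ m * M.
  elim: m => [|m IH].
    rewrite addn0 expr0 !mulr1 (le_trans (i0P r)) // ler_peMl //.
    by rewrite lerDl invr_ge0 ltW.
  rewrite mulSn addnCA addnC vk (le_trans (cabsD _ _ _)) //.
  rewrite cabsM.
  apply: (le_trans (lerD (ler_pM (cabs_ge0 _ _) (cabs_ge0 _ _) mu2r IH) (dM r m))).
  rewrite le_eqVlt; apply/orP; left; apply/eqP.
  by rewrite -[m.+2%:R]natr1 exprS; field; rewrite gt_eqF.
rewrite ceil_divS //= [n in cabs (v n)](divn_eq n k) addnC.
have [M_eq0|M_neq0] := eqVneq M 0.
  rewrite M_eq0 invr0 mulr0 !mulr_ge0 ?exprn_ge0 ?ltW //.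
  by rewrite addr_gt0 ?invr_gt0.
by rewrite ler_pdivrMr // lt0r M_neq0.
Qed.

End Summability.

Section Argument.
Local Open Scope classical_set_scope.
Variable R : realType.
Local Notation C := (R[i]).
Implicit Types (x y z : C) (s t : R).

Lemma expiD s t : expi (s + t) = expi s * expi t.
Proof. by rewrite /expi cosD sinD; simpc; congr (_ +i* _)%C; rewrite addrC. Qed.

Lemma expi0 : expi (0 : R) = 1.
Proof. by rewrite /expi cos0 sin0. Qed.

Lemma expiN t : expi (- t) = (expi t)^-1.
Proof.
have e : expi (- t) * expi t = 1 by rewrite -expiD addNr expi0.
have t0 : expi t != 0.
  by apply: contra_eq_neq e => ->; rewrite mulr0 eq_sym oner_neq0.
by apply: (mulIf t0); rewrite e mulVf.
Qed.

Lemma expi_neq0 t : expi t != 0.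
Proof.
apply: contra_eq_neq (expiD t (- t)) => ->.
by rewrite subrr expi0 mul0r oner_neq0.
Qed.

Lemma expi_2pi : expi (2 * pi : R) = 1.
Proof. by rewrite /expi mulr_natl cos2pi sin2pi. Qed.

Lemma cabs_expi t : cabs (expi t) = 1.
Proof. by rewrite /cabs /expi /= cos2Dsin2 sqrtr1. Qed.

Lemma expi_onto_circle z : cabs z = 1 ->
  exists2 t : R, 0 <= t <= 1 & expi (2 * pi * t) = z.
Proof.
case: z => p q; rewrite /cabs /= => n1.
have pq : p ^+ 2 + q ^+ 2 = 1.
  by rewrite -[LHS]sqr_sqrtr ?n1 ?expr1n // addr_ge0 // sqr_ge0.
have p1 : -1 <= p <= 1.
  by rewrite -ler_norml -(@ler_pXn2r _ 2) ?nnegrE // real_normK ?num_real //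
    expr1n -pq lerDl sqr_ge0.
have pi_gt0 := pi_gt0 R.
have pp : 0 < 2 * pi :> R by rewrite mulr_gt0.
have sq : sin (acos p) = `|q|.
  by rewrite sin_acos // -pq addrC addKr sqrtr_sqr.
have cp : cos (acos p) = p by rewrite acosK // in_itv.
have a0 := acos_ge0 p1; have api := acos_lepi p1.
have [q0|q0] := leP 0 q.
  exists (acos p / (2 * pi)).
    by rewrite divr_ge0 ?(ltW pp) //= ler_pdivrMr // mul1r; lra.
  by rewrite mulrCA divff ?gt_eqF // mulr1 /expi cp sq ger0_norm.
exists (1 - acos p / (2 * pi)).
  rewrite lerBlDr lerDl divr_ge0 ?(ltW pp) // andbT subr_ge0.
  by rewrite ler_pdivrMr // mul1r; lra.
rewrite mulrBr mulr1 expiD expi_2pi mul1r mulrCA divff ?gt_eqF // mulr1.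
by rewrite /expi cosN sinN cp sq ltr0_norm // opprK.
Qed.

Definition is_arg z t : Prop := z = (cabs z)%:C%C * expi t.

Lemma is_argM x y s t : is_arg x s -> is_arg y t -> is_arg (x * y) (s + t).
Proof.
rewrite /is_arg => ex ey; rewrite cabsM rmorphM /= expiD {1}ex {1}ey; ring.
Qed.

Lemma is_argV x s : is_arg x s -> is_arg x^-1 (- s).
Proof.
by rewrite /is_arg => ex; rewrite cabsV {1}ex expiN invfM fmorphV.
Qed.

Lemma is_arg_div x y s t : is_arg x s -> is_arg y t -> is_arg (x / y) (s - t).
Proof. by move=> ex ey; apply: is_argM => //; apply: is_argV. Qed.

Lemma is_arg_expi t : is_arg (expi t) t.
Proof. by rewrite /is_arg cabs_expi mul1r. Qed.

Lemma is_arg_inj z s t : z != 0 -> is_arg z s -> is_arg z t -> expi (s - t) = 1.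
Proof.
move=> z0 es et; rewrite expiD expiN; apply/eqP.
rewrite -[_ == _](inj_eq (mulIf (expi_neq0 t))) divfK ?expi_neq0 // mul1r.
have z0' : (cabs z)%:C%C != 0 :> C.
  by rewrite -[0]/(0%:C%C) (inj_eq (@complexI R)) cabs_eq0.
by apply/eqP/(mulfI z0'); rewrite -es -et.
Qed.

Lemma is_arg_atan z :
  0 < complex.Re z -> is_arg z (atan (complex.Im z / complex.Re z)).
Proof.
case: z => p q /= p0; rewrite /is_arg /cabs /expi /=.
have -> : sin (atan (q / p)) = q / p * cos (atan (q / p)).
  rewrite -{2}(atanK (q / p)) /tan divfK // gt_eqF // cos_gt0_pihalf //.
  by rewrite atan_gtNpi2 atan_ltpi2.
rewrite cos_atan.
have -> : p ^+ 2 + q ^+ 2 = p ^+ 2 * (1 + (q / p) ^+ 2).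
  by field; rewrite gt_eqF.
rewrite sqrtrM ?sqr_ge0 // sqrtr_sqr gtr0_norm //.
set S := Num.sqrt _; have S0 : S != 0.
  by rewrite gt_eqF // sqrtr_gt0 ltr_pwDl // sqr_ge0.
by simpc; congr (_ +i* _)%C; field; rewrite ?S0 ?gt_eqF.
Qed.

(* A continuous lift of the constant curve 1 cannot pass through odd multiples
   of pi. *)
Lemma lift_of_one (h : R -> R) (q : int) :
  {within `[0, 1]%classic, continuous h} ->
  (forall t, 0 <= t <= 1 -> expi (h t) = 1) ->
  h 1 - h 0 = 2 * pi * q%:~R -> q = 0.
Proof.
wlog q0 : h q / 0 <= q => [wh|] hc h1 hq.
  have [|q0] := leP 0 q; first by move=> q0; apply: (wh h).
  apply/eqP; rewrite -oppr_eq0; apply/eqP; apply: (wh (fun t => - h t)).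
  - by rewrite oppr_ge0 ltW.
  - by move=> t; apply: cvgN; apply: hc.
  - by move=> t /h1 e; rewrite expiN e invr1.
  - by rewrite mulrNz mulrN -hq; ring.
apply/eqP; rewrite eq_le q0 andbT leNgt; apply/negP => q1.
have q1' : 1 <= q%:~R :> R by rewrite -[1]/(1%:~R) ler_int -gtz0_ge1.
have pi_gt0 := pi_gt0 R.
have h01 : h 0 + pi <= h 1.
  have : 2 * pi * 1 <= 2 * pi * q%:~R :> R by rewrite ler_wpM2l // mulr_ge0 // ltW.
  by rewrite -hq; lra.
have h01' : h 0 <= h 1 by lra.
have [|t] := @IVT R h 0 1 (h 0 + pi) ler01 hc.
  by rewrite min_l // max_r // h01 andbT lerDl ltW.
rewrite in_itv /= => t01 ht.
have := h1 _ t01; rewrite ht expiD h1 ?lexx ?ler01 // mul1r => -[].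
by rewrite cospi => /eqP; rewrite -subr_eq0 -opprD oppr_eq0 paddr_eq0 // oner_eq0.
Qed.

Lemma winding_unique (g : R -> C) (w n : int) (L : R -> R) :
  winding g w -> {within `[0, 1]%classic, continuous L} ->
  (forall t, 0 <= t <= 1 -> is_arg (g t / g 0) (L t)) ->
  L 1 - L 0 = 2 * pi * n%:~R -> w = n.
Proof.
move=> [g0 [th [thc [tha thw]]]] Lc La Ln.
apply/eqP; rewrite -subr_eq0; apply/eqP.
apply: (@lift_of_one (fun t => (th t - th 0) - L t)).
- move=> t; apply: cvgB; last exact: Lc.
  by apply: cvgB; [exact: thc|exact: cvg_cst].
- move=> t t01; apply: (@is_arg_inj (g t / g 0)); last exact: La.
    by rewrite mulf_neq0 ?invr_eq0 ?g0 // lexx ler01.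
  by apply: is_arg_div; apply: tha; rewrite ?lexx ?ler01.
- by rewrite rmorphB /= mulrBr -thw -Ln; ring.
Qed.

Lemma Re_one_sub_gt0 z : cabs z < 1 -> 0 < complex.Re (1 - z).
Proof.
case: z => p q; rewrite /cabs /= => n1; rewrite subr_gt0.
apply: (le_lt_trans _ n1); apply: (le_trans (ler_norm _)).
by rewrite -sqrtr_sqr ler_wsqrtr // lerDl sqr_ge0.
Qed.

Lemma lift_one_sub z s : cabs z < 1 -> expi s = 1 ->
  exists L : R -> R, [/\ continuous L,
    forall t, is_arg (1 - z * expi (s * t)) (L t) & L 1 = L 0].
Proof.
move=> z1 es.
pose f t : C := 1 - z * expi (s * t).
have f0 t : 0 < complex.Re (f t) by apply: Re_one_sub_gt0; rewrite cabsM cabs_expi mulr1.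
have ct : continuous (fun t => s * t) by move=> t; apply: mulrl_continuous.
have cc : continuous (fun t => cos (s * t)).
  move=> t; apply: (@continuous_comp _ _ _ (fun t => s * t) cos);
    [exact: ct|exact: continuous_cos].
have cs : continuous (fun t => sin (s * t)).
  move=> t; apply: (@continuous_comp _ _ _ (fun t => s * t) sin);
    [exact: ct|exact: continuous_sin].
have cRe : continuous (fun t => complex.Re (f t)).
  rewrite /f; case: (z) => p q /= t.
  by apply: cvgB; [exact: cvg_cst|apply: cvgB; apply: cvgM;
    (exact: cvg_cst||apply: cc||apply: cs)].
have cIm : continuous (fun t => complex.Im (f t)).
  rewrite /f; case: (z) => p q /= t.
  by apply: cvgB; [exact: cvg_cst|apply: cvgD; apply: cvgM;
    (exact: cvg_cst||apply: cc||apply: cs)].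
exists (fun t => atan (complex.Im (f t) / complex.Re (f t))); split.
- move=> t; apply: (@continuous_comp _ _ _
    (fun t => complex.Im (f t) / complex.Re (f t)) atan); last exact: continuous_atan.
  by apply: cvgM; [exact: cIm|apply: cvgV; [rewrite gt_eqF|exact: cRe]].
- by move=> t; exact: (is_arg_atan (f t) (f0 t)).
- by rewrite /f mulr0 mulr1 es expi0.
Qed.

Lemma one_sub_neq0 z : cabs z != 1 -> 1 - z != 0.
Proof.
by apply: contra_neq => /eqP; rewrite subr_eq0 => /eqP <-; apply: Normc.normc1.
Qed.

Lemma lift_linear_factor z : cabs z != 1 ->
  exists L : R -> R, [/\ continuous L,
    forall t, is_arg ((expi (2 * pi * t) - z) / (1 - z)) (L t)
    & L 1 - L 0 = 2 * pi * (cabs z < 1)%R%:R].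
Proof.
move=> z1; have clin : continuous (fun t : R => 2 * pi * t).
  by move=> t; apply: mulrl_continuous.
have [zlt|zge] := ltP (cabs z) 1.
  have [|L [Lc La L10]] := @lift_one_sub z (- (2 * pi)) zlt.
    by rewrite expiN expi_2pi invr1.
  exists (fun t => 2 * pi * t + (L t - L 0)); split.
  - move=> t; apply: cvgD; first exact: clin.
    by apply: cvgB; [exact: Lc|exact: cvg_cst].
  - move=> t.
    have -> : (expi (2 * pi * t) - z) / (1 - z) =
       expi (2 * pi * t) *
       ((1 - z * expi (- (2 * pi) * t)) / (1 - z * expi (- (2 * pi) * 0))).
      rewrite mulr0 expi0 mulr1 mulNr expiN mulrA; congr (_ / _).
      by rewrite mulrBr mulr1 mulrCA divff ?expi_neq0 // mulr1.
    by apply: is_argM; [exact: is_arg_expi|apply: is_arg_div; apply: La].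
  - by rewrite L10 /= mulr1n; ring.
have {zge z1}z1 : 1 < cabs z by rewrite lt_neqAle eq_sym z1.
have z0 : z != 0 by rewrite -cabs_gt0 (lt_trans ltr01).
have [||L [Lc La L10]] := @lift_one_sub z^-1 (2 * pi).
- by rewrite cabsV invf_lt1 // (lt_trans ltr01).
- exact: expi_2pi.
exists (fun t => L t - L 0); split.
- by move=> t; apply: cvgB; [exact: Lc|exact: cvg_cst].
- move=> t.
  have -> : (expi (2 * pi * t) - z) / (1 - z) =
     (1 - z^-1 * expi (2 * pi * t)) / (1 - z^-1 * expi (2 * pi * 0)).
    have z1' : 1 - z != 0 by rewrite one_sub_neq0 ?gt_eqF.
    rewrite mulr0 expi0 mulr1; field.
    by rewrite z0 z1' -opprB oppr_eq0 z1'.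
  by apply: is_arg_div; apply: La.
- by rewrite L10 /= mulr0n; ring.
Qed.

Lemma winding_lt0_roots (g : R -> C) (w : int) (al z1 z2 : C) :
  (forall t, g t = al * (expi (2 * pi * t) - z1) * (expi (2 * pi * t) - z2)
      / expi (2 * pi * t)) ->
  winding g w -> (w < 0)%R -> 1 < cabs z1 /\ 1 < cabs z2.
Proof.
move=> gE gw w0; have [g0 _] := gw.
have al0 : al != 0.
  have := g0 0; rewrite lexx ler01 => /(_ isT); apply: contra_neq => e.
  by rewrite gE e !mul0r.
have roots1 z : (z == z1) || (z == z2) -> cabs z != 1.
  move=> zz; apply/eqP => /expi_onto_circle [t /g0 + tz].
  rewrite gE tz => /eqP; apply; case/orP: zz => /eqP ->; rewrite subrr; ring.
have n1 : cabs z1 != 1 by apply: roots1; rewrite eqxx.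
have n2 : cabs z2 != 1 by apply: roots1; rewrite eqxx orbT.
have [L1 [c1 a1 w1]] := lift_linear_factor z1 n1.
have [L2 [c2 a2 w2]] := lift_linear_factor z2 n2.
have wE : w = (cabs z1 < 1)%R%:R + (cabs z2 < 1)%R%:R - 1.
  apply: (@winding_unique g _ _ (fun t => L1 t + L2 t - 2 * pi * t) gw).
  - apply: continuous_subspaceT => t; apply: cvgB; last exact: mulrl_continuous.
    by apply: cvgD; [exact: c1|exact: c2].
  - move=> t t01.
    have -> : g t / g 0 = (expi (2 * pi * t) - z1) / (1 - z1)
        * ((expi (2 * pi * t) - z2) / (1 - z2)) / expi (2 * pi * t).
      by rewrite !gE mulr0 expi0; field; rewrite al0 expi_neq0 !one_sub_neq0.
    by apply: is_arg_div; [apply: is_argM|exact: is_arg_expi].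
  - transitivity ((L1 1 - L1 0) + (L2 1 - L2 0) - 2 * pi); first by ring.
    by rewrite w1 w2 rmorphB rmorphD /= !rmorph_nat; ring.
move: w0; rewrite wE; move: n1 n2.
by case: (ltgtP (cabs z1) 1) => // _ _; case: (ltgtP (cabs z2) 1).
Qed.

End Argument.

Section Eigenvectors.
Local Open Scope classical_set_scope.
Variable R : realType.
Local Notation C := (R[i]).

Lemma quadratic_factor (al D be : C) : al != 0 ->
  exists z1 z2 : C, forall z, al * z ^+ 2 + D * z + be = al * (z - z1) * (z - z2).
Proof.
move=> al0; set r := sqrtc (D ^+ 2 - 4 * al * be).
have rE : r ^+ 2 = D ^+ 2 - 4 * al * be by apply: sqr_sqrtc.
exists ((- D + r) / (2 * al)), ((- D - r) / (2 * al)) => z.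
have beE : be = (D ^+ 2 - r ^+ 2) / (4 * al) by rewrite rE; field.
by rewrite beE; field.
Qed.

Lemma mx_rightS k (a b c : nat -> C) a0 x m :
  mx_right (Tent k a b c a0) x m.+1 =
  c (lab k m) * x m + a (lab k m.+1) * x m.+1 + b (lab k m.+1) * x m.+2.
Proof.
rewrite /mx_right !big_nat_recr //= big_nat big1 ?add0r => [|j /andP[_ jm]].
  rewrite /Tent !eqxx /= addr0 (gtn_eqF (ltnSn m)).
  by rewrite (ltn_eqF (leqW (ltnSn m))) (ltn_eqF (ltnSn m.+1)).
rewrite /Tent (gtn_eqF (leqW jm)) (ltn_eqF (leqW (leqW jm))).
by rewrite eqSS (gtn_eqF jm) mul0r.
Qed.

Lemma eigenvector_bulk_sol k (a b c : nat -> C) lam a0 x :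
  (a 1%N + a0 - lam) * x 0%N + b 1%N * x 1%N = 0 -> bulk_sol R a b c lam k x ->
  mx_right (Tent k a b c a0) x = (fun n => lam * x n).
Proof.
move=> x0 sx; apply/funext => -[|m]; apply/eqP; rewrite -subr_eq0; apply/eqP.
  rewrite /mx_right !big_nat_recr //= big_geq // /Tent /= /lab mod0n -[RHS]x0.
  by ring.
by rewrite mx_rightS -[RHS](sx m); ring.
Qed.

Lemma bulk_sol_exists k (a b c : nat -> C) lam (x0 x1 : C) : (0 < k)%N ->
  \prod_(1 <= j < k.+1) b j != 0 ->
  exists x, [/\ bulk_sol R a b c lam k x, x 0%N = x0 & x 1%N = x1].
Proof.
move=> k0 b0.
pose F := fix F n : C * C := if n is m.+1 then
   ((F m).2, - (c (lab k m) * (F m).1 + (a (lab k m.+1) - lam) * (F m).2)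
      / b (lab k m.+1)) else (x0, x1).
exists (fun n => (F n).1); split=> // n; rewrite /= -/F.
by rewrite [b _ * _]mulrC divfK ?subrr // b_lab_neq0.
Qed.

Lemma right_eigenvector k (a b c : nat -> C) (lam : C) : (0 < k)%N ->
  \prod_(1 <= j < k.+1) c j != 0 -> \prod_(1 <= j < k.+1) b j != 0 ->
  exists2 Cst : R, 0 < Cst & forall (a0 : C) (w : int),
    winding (det_curve k a b c lam) w -> (w < 0)%R ->
    exists (x : nat -> C) (rho : R),
      [/\ in_l2 x, x <> (fun _ => 0),
          mx_right (Tent k a b c a0) x = (fun n => lam * x n),
          0 <= rho < 1 & decays k Cst rho x].
Proof.
move=> k0 c0 b0.
have [D DE] := det_symb R a b c lam k k0.
set pb := \prod_(_ <= j < _) b j in b0 DE.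
set pc := \prod_(_ <= j < _) c j in c0 DE.
have s0 : (-1) ^+ k.-1 != 0 :> C by rewrite signr_eq0.
have al0 : (-1) ^+ k.-1 * pc != 0 by rewrite mulf_neq0.
have [z1 [z2 zE]] := quadratic_factor _ D ((-1) ^+ k.-1 * pb) al0.
have z12 : pc * (z1 * z2) = pb.
  by have := zE 0; rewrite expr0n /= !mulr0 !add0r => e;
    apply: (mulfI s0); rewrite e; ring.
have z12_neq0 : z1 * z2 != 0.
  by apply: contra_neq b0 => e; rewrite -z12 e mulr0.
have [z1_neq0 z2_neq0] : z1 != 0 /\ z2 != 0.
  by apply/andP; rewrite -negb_or -mulf_eq0.
have detE z : z != 0 ->
    \det (symb k a b c z - lam%:M) = (-1) ^+ k.-1 * pc * (z - z1) * (z - z2) / z.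
  by move=> z0; rewrite DE // -zE; field.
pose rho := Num.max (cabs z1^-1) (cabs z2^-1).
have rho0 : 0 < rho by rewrite lt_max cabs_gt0 invr_eq0 z1_neq0.
exists (1 + rho^-1); first by rewrite addr_gt0 ?invr_gt0.
move=> a0 w gw w0.
have [z1_gt1 z2_gt1] : 1 < cabs z1 /\ 1 < cabs z2.
  apply: (winding_lt0_roots _ _ _ _ _ _ _ gw w0) => t.
  by rewrite /det_curve detE ?expi_neq0.
have rho1 : rho < 1.
  by rewrite gt_max !cabsV !invf_lt1 ?z1_gt1 ?z2_gt1 ?cabs_gt0.
have [|u [su uk u0]] := floquet_solution R a b c lam k z1 k0 b0 z1_neq0.
  by rewrite detE // subrr mulr0 !mul0r.
have [x [sx x0 x1]] := bulk_sol_exists k a b c lam 1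
  (- (a 1%N + a0 - lam) / b 1%N) k0 b0.
have b1 : b 1%N != 0 by have := b_lab_neq0 _ _ _ k0 b0 0; rewrite /lab mod0n.
have [||kap xk] := floquet_shift R a b c lam k k0 b0 z1^-1 z2^-1
  u x _ _ su uk u0 sx.
- by rewrite invr_eq0.
- by rewrite -/pb -z12 -/pc; field; rewrite z1_neq0 z2_neq0.
have [xl2 xd] : in_l2 x /\ decays k (1 + rho^-1) rho x.
  apply: (floquet_decay _ _ _ _ _ _ _ _ k0 _ _ _ uk xk).
  - by rewrite rho0.
  - by rewrite le_max lexx.
  - by rewrite le_max lexx orbT.
exists x, rho; split=> //.
- by move=> e; have := oner_neq0 C; rewrite -x0 e eqxx.
- apply: eigenvector_bulk_sol => //.
  by rewrite x0 x1 mulr1 mulrC divfK // subrr.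
- by rewrite (ltW rho0).
Qed.

Lemma decaysW k (C1 C2 rho : R) (x : nat -> C) :
  0 <= rho -> C1 <= C2 -> decays k C1 rho x -> decays k C2 rho x.
Proof.
move=> rho0 C12 [i0 [xmax xd]]; exists i0; split=> // n.
by apply: (le_trans (xd n)); rewrite -!mulrA ler_wpM2r // mulr_ge0 ?exprn_ge0.
Qed.

Lemma Tent_tr k (a b c : nat -> C) a0 i j :
  Tent k a b c a0 i j = Tent k a c b a0 j i.
Proof.
rewrite /Tent eq_sym; have [->//|_] := eqVneq j i.
by have [->|//] := eqVneq j i.+1; rewrite ltn_eqF // leqW.
Qed.

Lemma mx_left_Tent k (a b c : nat -> C) a0 y :
  mx_left y (Tent k a b c a0) = mx_right (Tent k a c b a0) y.
Proof.
apply/funext => j; rewrite /mx_left /mx_right; apply: eq_bigr => i _.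
by rewrite Tent_tr mulrC.
Qed.

Lemma symb_tr k (a b c : nat -> C) z :
  (symb k a b c z)^T = symb k a c b z^-1.
Proof.
apply/matrixP => i j; rewrite !mxE invrK addrAC andbC; congr (_ + _ + _).
  rewrite eq_sym; have [->//|_] := eqVneq (i : nat) j.
  by have [->|//] := eqVneq (j : nat) i.+1; rewrite (ltn_eqF (leqW (ltnSn i))).
by rewrite andbC.
Qed.

Lemma winding_rev (g h : R -> C) (w : int) :
  (forall t, h t = g (1 - t)) -> winding g w -> winding h (- w).
Proof.
move=> hg [g0 [th [thc [tha thw]]]].
have rev01 (t : R) : 0 <= t <= 1 -> 0 <= 1 - t <= 1 by move=> ?; lra.
split=> [t t01|]; first by rewrite hg g0 ?rev01.
exists (fun t => th (1 - t)); split; last split.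
- apply/subspace_continuousP => t t01.
  have t01' : (`[0, 1]%classic : set R) (1 - t).
    by move: t01; rewrite /= !in_itv /=; apply: rev01.
  move/subspace_continuousP: thc => /(_ _ t01') thc P /thc thP.
  have crev : {for t, continuous (fun x : R => 1 - x)}.
    by apply: cvgB; [exact: cvg_cst|exact: cvg_id].
  suff : nbhs t [set x : R | `[0, 1]%classic x -> P (th (1 - x))] by [].
  have {}thP : nbhs (1 - t) [set x : R | `[0, 1]%classic x -> P (th x)] by [].
  have crevP : nbhs t [set x : R | `[0, 1]%classic (1 - x) -> P (th (1 - x))].
    exact: (crev _ thP).
  apply: filterS crevP => x /= thx x01; apply: thx.
  by move: x01; rewrite /= !in_itv /=; apply: rev01.
- by move=> t t01; rewrite hg; apply: tha; apply: rev01.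
- by rewrite subrr subr0 mulrNz mulrN -thw opprB.
Qed.

Lemma det_curve_swap k (a b c : nat -> C) lam t :
  det_curve k a c b lam t = det_curve k a b c lam (1 - t).
Proof.
rewrite /det_curve -[RHS]det_tr linearB /= tr_scalar_mx symb_tr.
by rewrite mulrBr mulr1 expiD expi_2pi mul1r expiN invrK.
Qed.

End Eigenvectors.

Theorem theorem4p2 (R : realType) (k : nat) (a b c : nat -> R[i]) (lam : R[i]) :
  (0 < k)%N ->
  \prod_(1 <= j < k.+1) c j != 0 ->
  \prod_(1 <= j < k.+1) b j != 0 ->
  exists Cst : R, 0 < Cst /\
  forall a0 : R[i],
    ~ ess_spec (Tent k a b c a0) lam ->
    forall w : int, winding (det_curve k a b c lam) w ->
    ((w < 0)%R ->
       exists (x : nat -> R[i]) (rho : R),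
         [/\ in_l2 x, x <> (fun _ => 0),
             mx_right (Tent k a b c a0) x = (fun n => lam * x n),
             0 <= rho < 1 & decays k Cst rho x]) /\
    ((0 < w)%R ->
       exists (y : nat -> R[i]) (rho : R),
         [/\ in_l2 y, y <> (fun _ => 0),
             mx_left y (Tent k a b c a0) = (fun n => lam * y n),
             0 <= rho < 1 & decays k Cst rho y]).
Proof.
move=> k0 c0 b0.
have [C1 C1_gt0 right] := right_eigenvector R k a b c lam k0 c0 b0.
have [C2 C2_gt0 left] := right_eigenvector R k a c b lam k0 b0 c0.
exists (Num.max C1 C2); split; first by rewrite lt_max C1_gt0.
move=> a0 _ w gw; split=> w0.
  have [x [rho [xl2 x0 xe rho1 xd]]] := right a0 w gw w0.
  exists x, rho; split=> //; apply: decaysW xd; last by rewrite le_max lexx.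
  by case/andP: rho1.
have gw' := winding_rev _ _ _ _ (det_curve_swap R k a b c lam) gw.
have [|y [rho [yl2 y0 ye rho1 yd]]] := left a0 (- w) gw'.
  by rewrite oppr_lt0.
exists y, rho; split=> //; first by rewrite mx_left_Tent.
apply: decaysW yd; last by rewrite le_max lexx orbT.
by case/andP: rho1.
Qed.
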